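(* Let $d \geq 1$ and $n \geq 3$ be integers, and let $A_1, A_2, \dots, A_n \in M(d)$ be positive-semidefinite. Let $|||\cdot|||$ be a unitarily invariant norm on $M(d)$. Then $$\frac{1}{n^3} \sum_{i,j,k=1}^{n} |||A_i A_j A_k||| \;\geq\; \frac{(n-3)!}{n!} \sum_{\substack{i,j,k=1 \\ i,j,k \text{ all distinct}}}^{n} |||A_i A_j A_k|||.$$
   Context: $M(d)$ denotes the space of complex $d \times d$ matrices. A norm $|||\cdot|||$ on $M(d)$ is called unitarily invariant if $|||UX||| = |||XU||| = |||X|||$ for all $X, U \in M(d)$ with $U$ unitary. Positive-semidefinite matrices are Hermitian. The sum on the right is over all ordered triples of pairwise distinct indices. *)

(* Defs.v *)
From mathcomp Require Export all_boot all_order all_algebra.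
From mathcomp Require Export reals complex.

Set Implicit Arguments.
Unset Strict Implicit.
Unset Printing Implicit Defensive.

Import Order.TTheory GRing.Theory Num.Theory.

Local Open Scope ring_scope.
Local Open Scope sesquilinear_scope.

(* On R[i] the order is partial and 0 <= z says that z is real and
   nonnegative. *)
Definition psdmx (R : realType) (d : nat) (A : 'M[R[i]]_d) : Prop :=
  A \is hermsymmx /\ forall x : 'cV[R[i]]_d, 0 <= (x ^t* *m A *m x) 0 0.

(* Lmodule_isNormed over R[i] would make the norm R[i]-valued; here norms are
   R-valued, and Normc.normc is the R-valued modulus. Nonnegativity follows from
   the triangle inequality and homogeneity. *)
Record is_mxnorm (R : realType) (d : nat) (N : 'M[R[i]]_d -> R) : Prop :=
  IsMxNorm {
    mxnorm_triangle : forall X Y, N (X + Y) <= N X + N Y;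
    mxnorm_homog : forall (c : R[i]) X, N (c *: X) = Normc.normc c * N X;
    mxnorm_eq0 : forall X, N X = 0 -> X = 0
  }.

Definition unitarily_invariant (R : realType) (d : nat)
    (N : 'M[R[i]]_d -> R) : Prop :=
  forall X U : 'M[R[i]]_d, U \is unitarymx ->
    N (U *m X) = N X /\ N (X *m U) = N X.

(* Main.v *)
(** For positive semidefinite A, B, C, diagonalizing A B C by a singular value
    decomposition and expanding the positivity of (x - y)^* B (x - y) gives
    N(ABC) <= (N(ABA) + N(CBC)) / 2.  Since ABA is normal and has the same
    characteristic polynomial as A^2 B and B A^2, Schur triangularization and
    pinching to the diagonal give N(ABA) <= N(A^2 B), N(B A^2).  The two facts
    together yield N(ABA) <= (2 N(A^3) + N(B^3)) / 3.  Thus, if S, M, D are the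
    sums of N(A_i A_j A_k) over distinct triples, of N(A_i A_j A_i) over i != j,
    and of N(A_i^3), then S <= (n - 2) M and M <= (n - 1) D, while the full sum
    is at least S + 3 M + D; the theorem follows by arithmetic. *)
Require Import Defs.
From mathcomp Require Import fingroup perm lra ring.

Set Implicit Arguments.
Unset Strict Implicit.
Unset Printing Implicit Defensive.

Import Order.TTheory GRing.Theory Num.Theory.

Local Open Scope ring_scope.
Local Open Scope sesquilinear_scope.

(** Block elimination on [B] from the right gives [char_poly (P *m Q)]; elimination from the left
    gives [char_poly (Q *m P)], both sides gaining a factor ['X^n], which cancels. Neither matrix
    has to be invertible. *)
Lemma char_poly_mulmxC (F : fieldType) (n : nat) (P Q : 'M[F]_n) :
  char_poly (P *m Q) = char_poly (Q *m P).
Proof.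
pose p := map_mx polyC P; pose q := map_mx polyC Q.
pose B : 'M[{poly F}]_(n + n) := block_mx 'X%:M p q 1%:M.
have EPQ : \det B = char_poly (P *m Q).
  have : \det (B *m block_mx 1%:M 0 (- q) 1%:M) = char_poly (P *m Q).
    rewrite mulmx_block !(mulmx1, mul1mx, mulmx0, mulmxN, add0r, addrN).
    by rewrite det_ublock det1 mulr1 /char_poly /char_poly_mx map_mxM.
  by rewrite det_mulmx det_lblock !det1 !mulr1.
have : \det (block_mx 1%:M 0 (- q) 'X%:M *m B) = 'X^n * char_poly (Q *m P).
  rewrite mulmx_block !(mulmx1, mul1mx, mulmx0, mul0mx, mulNmx, add0r, addr0).
  rewrite mul_scalar_mx mul_mx_scalar addNr det_ublock det_scalar.
  by rewrite /char_poly /char_poly_mx map_mxM addrC.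
rewrite det_mulmx det_lblock det1 mul1r det_scalar EPQ.
by apply: mulfI; rewrite expf_neq0 // polyX_eq0.
Qed.

(** * Adjoints, unitary matrices and the singular value decomposition *)

Section Adjoint.
Variable C : numClosedFieldType.

Lemma adjmxM m n p (X : 'M[C]_(m, n)) (Y : 'M[C]_(n, p)) :
  (X *m Y)^t* = Y^t* *m X^t*.
Proof. by rewrite trmx_mul map_mxM. Qed.

Lemma adjmxB m n (X Y : 'M[C]_(m, n)) : (X - Y)^t* = X^t* - Y^t*.
Proof. by rewrite linearB map_mxB. Qed.

Lemma adjmx_diag n (v : 'rV[C]_n) : (diag_mx v)^t* = diag_mx (map_mx Num.conj v).
Proof. by rewrite tr_diag_mx map_diag_mx. Qed.

Lemma adjmx_herm n (X : 'M[C]_n) : X \is hermsymmx -> X^t* = X.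
Proof. by move=> /is_hermitianmxP; rewrite expr0 scale1r => <-. Qed.

Lemma unitarymx_adjl n (U : 'M[C]_n) : U \is unitarymx -> U^t* *m U = 1%:M.
Proof. by move=> U_un; rewrite -invmx_unitary // mulVmx // unitarymx_unit. Qed.

Lemma diag_unitary n (v : 'rV[C]_n) :
  (forall i, `|v 0 i| = 1) -> diag_mx v \is unitarymx.
Proof.
move=> v1; apply/unitarymxP; rewrite adjmx_diag mulmx_diag -diag_const_mx.
by congr diag_mx; apply/rowP=> i; rewrite !mxE -normCK v1 expr1n.
Qed.

Lemma mxE_gram m n (Z : 'M[C]_(m, n)) i :
  (Z *m Z^t*) i i = \sum_j `|Z i j| ^+ 2.
Proof. by rewrite mxE; apply: eq_bigr => j _; rewrite !mxE normCK. Qed.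

(* A zero row of [Z] is replaced by a vector orthogonal to all rows, which
   exists since [Z] is singular; this reduces to invertible [Z]. *)
Lemma orthogonal_rows_decomp n (s : 'rV[C]_n) (Z : 'M[C]_n) :
  Z *m Z^t* = diag_mx s ->
  exists2 V, V \is unitarymx & Z = diag_mx (map_mx sqrtC s) *m V.
Proof.
(* Induction on the number of zero entries of [s], that is, of zero rows of [Z]. *)
have [k] := ubnP #|[pred i | s 0 i == 0]|.
elim: k => // k IHk in s Z * => lek ZZ.
have sE i : s 0 i = \sum_j `|Z i j| ^+ 2.
  by rewrite -mxE_gram ZZ mxE eqxx mulr1n.
have s_ge0 i : 0 <= s 0 i by rewrite sE sumr_ge0 // => j _; rewrite exprn_ge0.
have [i0 si0|sn0] := pickP [pred i | s 0 i == 0]; last first.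
  pose r := map_mx (fun x => (sqrtC x)^-1) s.
  have rV : diag_mx (map_mx sqrtC s) *m diag_mx r = 1%:M.
    rewrite mulmx_diag -diag_const_mx; congr diag_mx; apply/rowP=> i.
    by rewrite !mxE divff // sqrtC_eq0; apply/negbT/sn0.
  exists (diag_mx r *m Z); last by rewrite mulmxA rV mul1mx.
  apply/unitarymxP; rewrite adjmxM -mulmxA (mulmxA Z) ZZ adjmx_diag.
  rewrite !mulmx_diag -diag_const_mx; congr diag_mx; apply/rowP=> i.
  rewrite !mxE (CrealP _) ?rpredV ?ger0_real ?sqrtC_ge0 //.
  rewrite mulrA mulrAC -expr2 exprVn sqrtCK mulVf //.
  exact/negbT/sn0.
have Zi0 j : Z i0 j = 0.
  move: si0; rewrite inE sE psumr_eq0 => [/allP/(_ j)|l _]; last exact: exprn_ge0.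
  by rewrite mem_index_enum expf_eq0 normr_eq0 => /(_ isT)/eqP.
(* A nonzero [v] in the left kernel of [Z^t*] is orthogonal to every row of [Z]. *)
have /eqP/det0P[v v0 vZ] : \det (Z^t*) = 0.
  have /eqP : \det (Z *m Z^t*) = 0.
    by rewrite ZZ det_diag (bigD1 i0) //= (eqP si0) mul0r.
  by rewrite det_mulmx mulf_eq0 det_map_mx det_tr conjC_eq0 orbb => /eqP->; rewrite rmorph0.
pose Z' := \matrix_(i, j) (if i == i0 then v 0 j else Z i j).
pose s' := \row_i (if i == i0 then (v *m v^t*) 0 0 else s 0 i).
have vv0 : (v *m v^t*) 0 0 != 0.
  apply: contra v0 => /eqP; rewrite mxE_gram => /eqP.
  rewrite psumr_eq0 => [/allP h|l _]; last exact: exprn_ge0.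
  apply/eqP/rowP=> j; rewrite mxE; apply/eqP; move: (h j).
  by rewrite mem_index_enum expf_eq0 normr_eq0 => /(_ isT).
have vZE j : \sum_l v 0 l * (Z j l)^* = 0.
  have := congr1 (fun X : 'rV_n => X 0 j) vZ; rewrite !mxE => vZj.
  by rewrite -[RHS]vZj; apply: eq_bigr => l _; rewrite !mxE.
have ZZE i j : \sum_l Z i l * (Z j l)^* = s 0 i *+ (i == j).
  have := congr1 (fun X : 'M_n => X i j) ZZ; rewrite !mxE => <-.
  by apply: eq_bigr => l _; rewrite !mxE.
have [||V V_un Z'E] := IHk s' Z'.
- rewrite -ltnS; apply: leq_trans lek; rewrite ltnS; apply: proper_card.
  apply/properP; split; last by exists i0; rewrite // !inE mxE eqxx.
  by apply/subsetP=> i; rewrite !inE mxE; case: ifP => // _; rewrite (negbTE vv0).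
- apply/matrixP=> i j; rewrite !mxE.
  under eq_bigr do rewrite !mxE.
  case: (eqVneq i i0) => [->|ii0].
    rewrite (eq_sym i0); case: eqP => _; last by rewrite mulr0n vZE.
    by rewrite mulr1n; apply: eq_bigr => l _; rewrite !mxE.
  case: (eqVneq j i0) => [->|ji0]; last exact: ZZE.
  rewrite (negbTE ii0) mulr0n -[RHS](rmorph0 Num.conj) -[in RHS](vZE i) rmorph_sum.
  by apply: eq_bigr => l _; rewrite rmorphM /= conjCK mulrC.
exists V => //; apply/matrixP=> i j.
have := congr1 (fun X : 'M_n => X i j) Z'E; rewrite !mul_diag_mx !mxE.
(* In row [i0] both sides vanish, so the replaced row leaves the factorization of [Z] intact. *)
have [->|//] := eqVneq i i0.
by rewrite Zi0 (eqP si0) sqrtC0 mul0r.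
Qed.

(** If [U] diagonalizes the normal matrix [M *m M^t*], then the rows of [U *m M] are orthogonal, and
    the preceding decomposition supplies [V]. *)
Lemma svd n (M : 'M[C]_n) : exists U V (p : 'rV[C]_n),
  [/\ U \is unitarymx, V \is unitarymx, forall i, 0 <= p 0 i &
      U *m M *m V^t* = diag_mx p].
Proof.
have /orthomx_spectralP : M *m M^t* \is normalmx.
  by apply/normalmxP; rewrite adjmxM trmxCK.
set U := spectralmx _; set s := spectral_diag _ => MME.
have U_un : U \is unitarymx := spectral_unitarymx _.
have ZZ : (U *m M) *m (U *m M)^t* = diag_mx s.
  rewrite adjmxM mulmxA -(mulmxA U) MME !mulmxA mulmxV ?unitarymx_unit //.
  by rewrite mul1mx -mulmxA (unitarymxP U_un) mulmx1.
have [V V_un ZE] := orthogonal_rows_decomp ZZ.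
exists U, V, (map_mx sqrtC s); split => // [i|]; last first.
  by rewrite ZE -mulmxA (unitarymxP V_un) mulmx1.
rewrite mxE sqrtC_ge0; have := mxE_gram (U *m M) i.
rewrite ZZ mxE eqxx mulr1n => ->; apply: sumr_ge0 => j _; exact: exprn_ge0.
Qed.

End Adjoint.

(** * Unitarily invariant norms: diagonal matrices, pinching and spectra *)

Section UnitarilyInvariantNorm.
Variables (R : realType) (d : nat) (N : 'M[R[i]]_d -> R).
Hypotheses (hN : is_mxnorm N) (hU : unitarily_invariant N).
Implicit Types X Y P Q : 'M[R[i]]_d.

Lemma mxnormUl U X : U \is unitarymx -> N (U *m X) = N X.
Proof. by move=> /hU -/(_ X)[]. Qed.

Lemma mxnormUr U X : U \is unitarymx -> N (X *m U) = N X.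
Proof. by move=> /hU -/(_ X)[]. Qed.

Lemma mxnorm_conj U X : U \is unitarymx -> N (U *m X *m U^t*) = N X.
Proof. by move=> U_un; rewrite mxnormUr ?trmxC_unitary // mxnormUl. Qed.

Lemma normc_half : Normc.normc (2^-1 : R[i]) = 2^-1.
Proof. by rewrite Normc.normcV -[2]/(1 *+ 2) normcMn Normc.normc1. Qed.

Lemma mxnorm_avg X Y : N (2^-1 *: (X + Y)) <= 2^-1 * (N X + N Y).
Proof.
rewrite (mxnorm_homog hN) normc_half ler_pM2l ?invr_gt0 ?ltr0n //.
exact: mxnorm_triangle hN _ _.
Qed.

(* A number c in [0, 1] is the mean of the unit complex numbers c + i w and
   c - i w, where w = sqrt (1 - c^2). *)
Lemma mxnorm_diag_le (p q : 'rV[R[i]]_d) :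
  (forall i, 0 <= p 0 i <= q 0 i) -> N (diag_mx p) <= N (diag_mx q).
Proof.
move=> pq; pose c i := p 0 i / q 0 i; pose w i := 'i * sqrtC (1 - c i ^+ 2).
have c01 i : 0 <= c i <= 1.
  have /andP[p0 le_pq] := pq i; have q0 := le_trans p0 le_pq.
  (* When [q 0 i = 0], division by zero gives [c i = 0]; then [p 0 i = 0] too, so [p = c q] still
     holds. *)
  rewrite divr_ge0 //=; move: q0; rewrite le_eqVlt => /predU1P[q0|q0].
    by rewrite /c -q0 invr0 mulr0 ler01.
  by rewrite ler_pdivrMr // mul1r.
have w_real i : sqrtC (1 - c i ^+ 2) \is Num.real.
  have /andP[c0 c1] := c01 i.
  by rewrite ger0_real // sqrtC_ge0 subr_ge0 exprn_ile1.
have c_real i : c i \is Num.real by have /andP[/ger0_real] := c01 i.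
have unit_uv (e : R[i]) i : e ^+ 2 = 1 -> e \is Num.real -> `|c i + e * w i| = 1.
  move=> e2 er; apply/eqP; rewrite -(eqrXn2 (ltn0Sn 1)) ?normr_ge0 ?ler01 //.
  rewrite /w mulrCA normC2_rect ?c_real ?realM //.
  by rewrite [(e * _) ^+ 2]exprMn e2 mul1r sqrtCK addrC subrK expr1n.
pose u e := diag_mx (\row_i (c i + e * w i)).
have u_un e : e ^+ 2 = 1 -> e \is Num.real -> u e \is unitarymx.
  by move=> e2 er; apply: diag_unitary => i; rewrite mxE unit_uv.
have -> : diag_mx p = 2^-1 *: (u 1 *m diag_mx q + u (-1) *m diag_mx q).
  rewrite !mulmx_diag; apply/matrixP=> i j; rewrite !mxE.
  case: eqP => [_|_]; last by rewrite !mulr0n addr0 mulr0.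
  rewrite !mulr1n mul1r mulN1r -mulrDl addrACA addrN addr0 -mulr2n.
  rewrite -[c i *+ 2]mulr_natl -mulrA mulKf ?pnatr_eq0 // /c.
  have /andP[p0 le_pq] := pq i; have [q0|q0] := eqVneq (q 0 i) 0.
    by rewrite q0 mulr0; apply/le_anti; rewrite p0 -q0 le_pq.
  by rewrite divfK.
apply: le_trans (mxnorm_avg _ _) _.
rewrite !mxnormUl ?u_un ?sqrrN ?expr1n ?rpredN ?rpred1 //; lra.
Qed.

(** Conjugation by the diagonal sign matrix with -1 at [k] negates the off-diagonal entries of row
    and column [k]. Averaging with the original erases them without increasing the norm; this is
    repeated for every [k]. *)
Lemma mxnorm_pinching X : N (diag_mx (\row_i X i i)) <= N X.
Proof.
(* [T s] keeps an entry unless its position is off the diagonal in the row or column of some [k] in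
   [s]. *)
pose T s := \matrix_(i, j) (X i j *+ all (fun k => (i == k) == (j == k)) s).
suff NT s : N (T s) <= N X.
  apply: le_trans (NT (enum 'I_d)); rewrite le_eqVlt; apply/orP; left; apply/eqP.
  congr N; apply/matrixP=> i j; rewrite !mxE.
  have [->|ij] := eqVneq i j.
    by rewrite (_ : all _ _) //; apply/allP=> k _; rewrite eqxx.
  rewrite (_ : all _ _ = false) //; apply/allP=> /(_ i (mem_enum _ i)).
  by rewrite eqxx (eq_sym j) (negbTE ij).
elim: s => [|k s IHs].
  by rewrite le_eqVlt (_ : T [::] = X) ?eqxx //; apply/matrixP=> i j; rewrite mxE.
pose S : 'M[R[i]]_d := diag_mx (\row_j (-1) ^+ (j == k)).
have S_un : S \is unitarymx by apply: diag_unitary => i; rewrite mxE normr_sign.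
have -> : T (k :: s) = 2^-1 *: (T s + S *m T s *m S).
  apply/matrixP=> i j; rewrite mul_mx_diag mul_diag_mx !mxE /=.
  case: (i == k) (j == k) => [] [] /=; case: all => /=;
    rewrite ?(mulr0n, mulr1n, expr0, expr1, mulN1r, mulrN1, mul1r, mulr1, opprK,
              oppr0, addr0, addrN, mulr0) //;
    by apply: (canRL (mulKf _)); rewrite ?pnatr_eq0 // mulr_natl mulr2n.
apply: le_trans (mxnorm_avg _ _) _; rewrite mxnormUr // mxnormUl //; lra.
Qed.

(* With [U (X^* P Y) V^* = diag p], [x = X U^*] and [y = Y V^*], positivity of
   [(x - y)^* P (x - y)] bounds [p] by the diagonal of the mean. *)
Lemma mxnorm_psd_cauchy_schwarz X P Y : psdmx P ->
  N (X^t* *m P *m Y) <=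
    2^-1 * (N (X^t* *m P *m X) + N (Y^t* *m P *m Y)).
Proof.
move=> [P_herm P_ge0].
have [U [V [p [U_un V_un p_ge0 UV]]]] := svd (X^t* *m P *m Y).
pose x := X *m U^t*; pose y := Y *m V^t*.
pose Q := 2^-1 *: (x^t* *m P *m x + y^t* *m P *m y).
have xPy : x^t* *m P *m y = diag_mx p by rewrite -UV adjmxM trmxCK !mulmxA.
have yPx : y^t* *m P *m x = diag_mx p.
  have -> : y^t* *m P *m x = (x^t* *m P *m y)^t*.
    move: x y {xPy Q} => x y.
    by rewrite !adjmxM trmxCK (adjmx_herm P_herm) mulmxA.
  rewrite xPy adjmx_diag; congr diag_mx; apply/rowP=> i.
  by rewrite mxE (CrealP _) // ger0_real.
have pQ i : p 0 i <= Q i i.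
  (* The quadratic form at column [i] of [x - y] is a diagonal entry, whose two cross terms both
     equal [p 0 i]. *)
  have := P_ge0 (col i (x - y)).
  have -> : ((col i (x - y))^t* *m P *m col i (x - y)) 0 0 =
            ((x - y)^t* *m P *m (x - y)) i i.
    rewrite tr_col map_row -row_mul mxE [RHS]mxE.
    by apply: eq_bigr => l _; rewrite [row _ _ _ _]mxE [col _ _ _ _]mxE.
  rewrite adjmxB !(mulmxBl, mulmxBr) xPy yPx /Q.
  move: (x^t* *m P *m x) (y^t* *m P *m y) => G H.
  rewrite !mxE eqxx !mulr1n => h.
  rewrite ler_pdivlMl ?ltr0n // mulr_natl mulr2n -subr_ge0.
  by move: h; rewrite opprB addrACA -opprD.
have NX : N (x^t* *m P *m x) = N (X^t* *m P *m X).
  by rewrite -(mxnorm_conj (X^t* *m P *m X) U_un) adjmxM trmxCK !mulmxA.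
have NY : N (y^t* *m P *m y) = N (Y^t* *m P *m Y).
  by rewrite -(mxnorm_conj (Y^t* *m P *m Y) V_un) adjmxM trmxCK !mulmxA.
rewrite -NX -NY; apply: le_trans (mxnorm_avg _ _); rewrite -/Q.
apply: le_trans (mxnorm_pinching Q).
have -> : N (X^t* *m P *m Y) = N (diag_mx p).
  by rewrite -UV [RHS]mxnormUr ?trmxC_unitary // [RHS]mxnormUl.
by apply: mxnorm_diag_le => i; rewrite p_ge0 mxE pQ.
Qed.

(** Permutation matrices are unitary and intertwine the two diagonal matrices. *)
Lemma mxnorm_diag_perm (p q : 'rV[R[i]]_d) :
  perm_eq [seq p 0 i | i : 'I_d] [seq q 0 i | i : 'I_d] ->
  N (diag_mx p) = N (diag_mx q).
Proof.
move=> pq; pose tp := [tuple p 0 i | i < d]; pose tq := [tuple q 0 i | i < d].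
have /tuple_permP[s sE] : perm_eq tp tq by [].
have pE i : p 0 i = q 0 (s i).
  have := congr1 (fun t => nth 0 t i) sE.
  by rewrite -!tnth_nth !tnth_mktuple.
have un_s t : (perm_mx t : 'M[R[i]]_d) \is unitarymx.
  by apply/unitarymxP; rewrite tr_perm_mx map_perm_mx -perm_mxM mulgV perm_mx1.
rewrite -(mxnormUr (diag_mx p) (un_s s)) -(mxnormUl (diag_mx q) (un_s s)).
congr N; apply/matrixP=> i j; rewrite mul_diag_mx -row_permE !mxE pE.
by rewrite mulr_natr.
Qed.

(** Up to unitary conjugation, [X] is the diagonal of its eigenvalues, and [Y] is triangular with
    the same eigenvalues on its diagonal; pinching the latter leaves the former up to order. *)
Lemma mxnorm_normal_le X Y : (0 < d)%N -> X \is normalmx ->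
  char_poly X = char_poly Y -> N X <= N Y.
Proof.
move=> d0 /orthomx_spectralP XE XY.
have [Q Q_un] := Schur Y d0; rewrite /similar_to conjymx //.
set T := Q *m Y *m _ => T_trig.
have U_un := spectral_unitarymx X; set U := spectralmx X in U_un XE.
set s := spectral_diag X in XE.
rewrite -(mxnorm_conj Y Q_un) -/T; apply: le_trans (mxnorm_pinching T).
have -> : N X = N (diag_mx s).
  by rewrite XE invmx_unitary // mxnormUr // mxnormUl ?trmxC_unitary.
suff -> : N (diag_mx s) = N (diag_mx (\row_i T i i)) by [].
have sT : char_poly (diag_mx s) = char_poly T.
  rewrite /T -mulmxA char_poly_mulmxC -mulmxA unitarymx_adjl // mulmx1 -XY XE.
  rewrite -mulmxA char_poly_mulmxC -mulmxA mulmxV ?mulmx1 //.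
  exact: unitarymx_unit.
(* Equal products of monic linear factors have the same roots with multiplicity. *)
apply: mxnorm_diag_perm; apply: prod_XsubC_eq; rewrite !big_image /=.
move: sT; rewrite !char_poly_trig ?diag_mx_is_trig // => sT.
rewrite (eq_bigr (fun i => 'X - (diag_mx s i i)%:P)) ?sT => [|i _].
  by apply: eq_bigr => i _; rewrite mxE.
by rewrite mxE eqxx mulr1n.
Qed.

Lemma mxnorm_mulC_le X Y : (0 < d)%N -> X *m Y \is normalmx ->
  N (X *m Y) <= N (Y *m X).
Proof. by move=> d0 XYn; apply: mxnorm_normal_le => //; exact: char_poly_mulmxC. Qed.

End UnitarilyInvariantNorm.

(** * Sums over index triples *)

Lemma sum_offdiag_sym (V : nmodType) (I : finType) (g : I -> I -> V) :
  \sum_i \sum_(j | j != i) g i j = \sum_i \sum_(j | j != i) g j i.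
Proof.
rewrite (exchange_big_dep predT) //=; apply: eq_bigr => i _.
by apply: eq_bigl => j; rewrite eq_sym.
Qed.

Lemma sum_triple_split (V : nmodType) (I : finType) (f : I -> I -> I -> V) :
  \sum_i \sum_j \sum_k f i j k =
  \sum_i \sum_j \sum_(k | [&& i != j, i != k & j != k]) f i j k
  + (\sum_i f i i i + \sum_i \sum_(j | j != i) (f i i j + f i j i + f i j j)).
Proof.
rewrite -!big_split; apply: eq_bigr => i _ /=.
rewrite (bigD1 i) //= [in RHS](bigD1 i) //= eqxx big_pred0_eq add0r.
rewrite (bigD1 i (F := fun k => f i i k)) //=.
rewrite -addrA [RHS]addrCA; congr (_ + _).
rewrite -!big_split /=; apply: eq_bigr => j ji.
rewrite (bigD1 i) //= (bigD1 j) //= [RHS]addrC -!addrA.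
do 3![congr (_ + _)]; apply: eq_bigl => k.
by rewrite (eq_sym i) (eq_sym i k) (eq_sym j k) ji.
Qed.

(** Each pair [i != j] leaves [n - 2] values of [k]; for [n < 2] there is no such pair, so
    truncation is harmless. *)
Lemma sum_distinct_card (V : nmodType) (n : nat) (g : 'I_n -> 'I_n -> V) :
  \sum_i \sum_j \sum_(k | [&& i != j, i != k & j != k]) g i j =
  (\sum_i \sum_(j | j != i) g i j) *+ (n - 2).
Proof.
rewrite -sumrMnl; apply: eq_bigr => i _; rewrite -sumrMnl [RHS]big_mkcond.
apply: eq_bigr => j _; rewrite eq_sym; case: eqVneq => [_|ji] /=.
  by rewrite big_pred0_eq.
rewrite sumr_const; congr (_ *+ _).
have -> : #|[pred k | (i != k) && (j != k)]| = #|~: [set i; j]|.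
  by apply: eq_card => k; rewrite !inE negb_or ![k == _]eq_sym.
by rewrite cardsCs setCK card_ord cards2 eq_sym ji.
Qed.

Lemma sum_distinct_rev (V : nmodType) (I : finType) (f : I -> I -> I -> V) :
  \sum_i \sum_j \sum_(k | [&& i != j, i != k & j != k]) f i j k =
  \sum_i \sum_j \sum_(k | [&& i != j, i != k & j != k]) f k j i.
Proof.
have swap (h : I -> I -> I -> V) :
    \sum_i \sum_j \sum_k h i j k = \sum_i \sum_j \sum_k h k j i.
  rewrite exchange_big [RHS]exchange_big; apply: eq_bigr => j _.
  exact: exchange_big.
transitivity (\sum_i \sum_j \sum_k
    (if [&& i != j, i != k & j != k] then f i j k else 0)).
  by apply: eq_bigr => i _; apply: eq_bigr => j _; rewrite big_mkcond.
rewrite swap; apply: eq_bigr => i _; apply: eq_bigr => j _.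
rewrite [RHS]big_mkcond; apply: eq_bigr => k _.
by rewrite (eq_sym k j) (eq_sym k i) (eq_sym j i); congr (if _ then _ else _);
   case: (i == j) (i == k) (j == k) => [] [] [].
Qed.

Lemma sum_triple_agm (R : realFieldType) (n : nat)
    (f : 'I_n -> 'I_n -> 'I_n -> R) : (3 <= n)%N ->
  (forall i j k, f i j k <= 2^-1 * (f i j i + f k j k)) ->
  (forall i j, f i j i <= f i i j) ->
  (forall i j, f i j i <= f j i i) ->
  (forall i j, f i j i <= 3^-1 * (2 * f i i i + f j j j)) ->
  ((n - 3)`!)%:R / (n`!)%:R *
    (\sum_i \sum_j \sum_(k | [&& i != j, i != k & j != k]) f i j k)
  <= 1 / n%:R ^+ 3 * (\sum_i \sum_j \sum_k f i j k).
Proof.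
move=> n3 f_cs f_l f_r f_young.
rewrite sum_triple_split; set S := \sum_i \sum_j \sum_(k | _) _.
set D := \sum_i f i i i; set E := \sum_i \sum_(j | _) _.
pose M := \sum_i \sum_(j | j != i) f i j i.
have SM : S <= M *+ (n - 2).
  have S_le : S <= \sum_i \sum_j \sum_(k | [&& i != j, i != k & j != k])
      2^-1 * (f i j i + f k j k).
    by do 2 ?[apply: ler_sum => ? _]; apply: ler_sum => k _; exact: f_cs.
  apply: le_trans S_le _.
  suff -> : \sum_i \sum_j \sum_(k | [&& i != j, i != k & j != k])
      2^-1 * (f i j i + f k j k) = M *+ (n - 2) by [].
  transitivity (\sum_i \sum_j \sum_(k | [&& i != j, i != k & j != k])
      2^-1 * f i j i +
    \sum_i \sum_j \sum_(k | [&& i != j, i != k & j != k]) 2^-1 * f k j k).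
    rewrite -big_split; apply: eq_bigr => i _; rewrite -big_split.
    apply: eq_bigr => j _; rewrite -big_split.
    by apply: eq_bigr => k _; rewrite mulrDr.
  (* Swapping [i] and [k] gives the second half the form of the first. *)
  rewrite [X in _ + X]sum_distinct_rev.
  rewrite (sum_distinct_card (fun i j => 2^-1 * f i j i)) -mulrnDl.
  congr (_ *+ _); rewrite -big_split; apply: eq_bigr => i _.
  by rewrite -big_split; apply: eq_bigr => j _ /=; lra.
have ME : 3 * M <= E.
  (* The third copy of [M] is transposed because [f_r] bounds [f i j j] below by [f j i j]. *)
  have -> : 3 * M = \sum_i \sum_(j | j != i) (f i j i + f i j i + f j i j).
    rewrite (_ : 3 * M = M + M + M); last by ring.
    rewrite [X in _ + X](sum_offdiag_sym (fun i j => f i j i)).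
    rewrite -!big_split; apply: eq_bigr => i _; rewrite -!big_split.
    by apply: eq_bigr.
  by do 2 ?[apply: ler_sum => ? _]; rewrite !lerD.
have MD : M <= (n%:R - 1) * D.
  have M_le : M <= \sum_i \sum_(j | j != i)
      (3^-1 * (f i i i + f i i i) + 3^-1 * f j j j).
    apply: ler_sum => i _; apply: ler_sum => j _.
    by have := f_young i j; lra.
  apply: le_trans M_le _.
  suff -> : \sum_i \sum_(j | j != i)
      (3^-1 * (f i i i + f i i i) + 3^-1 * f j j j) = (n%:R - 1) * D by [].
  transitivity (\sum_i \sum_(j | j != i) f i i i).
    under eq_bigr do rewrite big_split; rewrite big_split /=.
    rewrite [X in _ + X](sum_offdiag_sym (fun i j => 3^-1 * f j j j)).
    rewrite -big_split; apply: eq_bigr => i _; rewrite -big_split.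
    by apply: eq_bigr => j _ /=; lra.
  rewrite mulr_sumr; apply: eq_bigr => i _.
  rewrite sumr_const cardC1 card_ord -[LHS]mulr_natl -subn1 natrB //.
  exact: leq_trans n3.
move: SM MD; rewrite -[M *+ _]mulr_natl.
have [m ->] : exists m, n = m.+3 by exists (n - 3)%N; rewrite -addn3 subnK.
rewrite !subSS !subn0 !factS !natrM -(natr1 m.+2) -(natr1 m.+1) -(natr1 m).
have m0 : 0 <= m%:R :> R by rewrite ler0n.
have mf : m`!%:R != 0 :> R by rewrite pnatr_eq0 -lt0n fact_gt0.
move: (m%:R) (m`!%:R) m0 mf => x y x0 y0 SM MD.
(* Since [(x + 3)^2 - (x + 2)(x + 1) = 3 x + 7], the difference of the two sides is exactly the sum
   of the nonnegative quantities in [h1], [h2] and [h3]: the terms in [M] cancel. *)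
have key : (x + 3) ^+ 2 * S <= (x + 2) * (x + 1) * (S + (D + E)).
  have h1 : 0 <= (3 * x + 7) * ((x + 1) * M - S) by apply: mulr_ge0; lra.
  have h2 : 0 <= (x + 1) * ((x + 2) * D - M) by apply: mulr_ge0; lra.
  have h3 : 0 <= (x + 1) * (x + 2) * (E - 3 * M).
    by rewrite !mulr_ge0 //; lra.
  by lra.
rewrite -subr_ge0.
have -> : 1 / (x + 1 + 1 + 1) ^+ 3 * (S + (D + E)) -
    y / ((x + 1 + 1 + 1) * ((x + 1 + 1) * ((x + 1) * y))) * S =
    ((x + 2) * (x + 1) * (S + (D + E)) - (x + 3) ^+ 2 * S) /
    ((x + 3) ^+ 3 * (x + 2) * (x + 1)).
  by field; rewrite y0 !lt0r_neq0 //; lra.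
apply: divr_ge0; first by rewrite subr_ge0.
by rewrite !mulr_ge0 ?exprn_ge0 //; lra.
Qed.

(** * Norm inequalities for products of three positive semidefinite matrices *)

Section PsdTriples.
Variables (R : realType) (d : nat) (N : 'M[R[i]]_d -> R).
Hypotheses (d0 : (0 < d)%N) (hN : is_mxnorm N) (hU : unitarily_invariant N).
Implicit Types A B C : 'M[R[i]]_d.

Lemma mxnorm_psd_triple_le A B C : psdmx A -> psdmx B -> psdmx C ->
  N (A *m B *m C) <= 2^-1 * (N (A *m B *m A) + N (C *m B *m C)).
Proof.
move=> [A_herm _] B_psd [C_herm _].
have := mxnorm_psd_cauchy_schwarz hN hU A C B_psd.
by rewrite !adjmx_herm.
Qed.

Lemma normalmx_sandwich A B : psdmx A -> psdmx B -> A *m B *m A \is normalmx.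
Proof.
move=> [A_herm _] [B_herm _]; apply/normalmxP.
by rewrite !adjmxM !adjmx_herm // !mulmxA.
Qed.

(** The Hermitian, hence normal, product [(A *m B) *m A] turns into [A *m (A *m B)] when its two
    factors are exchanged. *)
Lemma mxnorm_sandwich_lel A B : psdmx A -> psdmx B ->
  N (A *m B *m A) <= N (A *m A *m B).
Proof.
move=> hA hB; rewrite -(mulmxA A A); apply: mxnorm_mulC_le => //.
exact: normalmx_sandwich.
Qed.

Lemma mxnorm_sandwich_ler A B : psdmx A -> psdmx B ->
  N (A *m B *m A) <= N (B *m A *m A).
Proof.
move=> hA hB; rewrite -(mulmxA A B); apply: mxnorm_mulC_le => //.
by rewrite mulmxA; apply: normalmx_sandwich.
Qed.

(* Eliminates [N (B A B)] between the two estimates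
   [N (A B A) <= N (A A B) <= (N (A A A) + N (B A B)) / 2] and its mirror. *)
Lemma mxnorm_sandwich_young A B : psdmx A -> psdmx B ->
  N (A *m B *m A) <= 3^-1 * (2 * N (A *m A *m A) + N (B *m B *m B)).
Proof.
move=> hA hB; have := mxnorm_sandwich_lel hA hB; have := mxnorm_sandwich_lel hB hA.
have := mxnorm_psd_triple_le hA hA hB; have := mxnorm_psd_triple_le hB hB hA.
lra.
Qed.

End PsdTriples.

Theorem theorem1p4 (R : realType) (d n : nat) (hd : (1 <= d)%N) (hn : (3 <= n)%N)
    (A : 'I_n -> 'M[R[i]]_d) (hA : forall i : 'I_n, psdmx (A i))
    (N : 'M[R[i]]_d -> R) (hN : is_mxnorm N) (hU : unitarily_invariant N) :
  1 / n%:R ^+ 3 *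
    (\sum_(i < n) \sum_(j < n) \sum_(k < n) N (A i *m A j *m A k))
  >= ((n - 3)`!)%:R / (n`!)%:R *
    (\sum_(i < n) \sum_(j < n) \sum_(k < n | [&& i != j, i != k & j != k])
       N (A i *m A j *m A k)).
Proof.
apply: sum_triple_agm => // *.
- exact: mxnorm_psd_triple_le.
- exact: mxnorm_sandwich_lel.
- exact: mxnorm_sandwich_ler.
- exact: mxnorm_sandwich_young.
Qed.
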